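(* Let $\alpha\in(0,\pi/2)$ and $\beta$ be fixed real values. The envelope of the family of lines through the point $p=\phi(u,v)\in S$ in the direction $v_{\alpha,\beta}$, i.e. of the family $$Q(\bar X,u,v)=\bar X-\phi(u,v)-r\,v_{\alpha,\beta},$$ has a solution if and only if either $$\beta=0\quad\text{and}\quad r=-\frac{2\sqrt{E}\,G}{\cos(\alpha)\,G_u-2\sin(\alpha)\sqrt{E}\,G\,\kappa_2},$$ or $$\beta=\frac{\pi}{2}\quad\text{and}\quad r=-\frac{2\sqrt{G}\,E}{\cos(\alpha)\,E_v-2\sin(\alpha)\sqrt{G}\,E\,\kappa_1}.$$
   Context: $S\subset\mathbb{R}^3$ is a smooth regular surface without parabolic points (points where the Gaussian curvature vanishes) and without umbilic points, with local parametrization $\phi:U\subset\mathbb{R}^2\to S$ whose coordinate curves are lines of curvature. $N$ is the unit normal of $S$; $E,G$ are the coefficients $\langle\phi_u,\phi_u\rangle,\langle\phi_v,\phi_v\rangle$ of the first fundamental form and $e,g$ the coefficients $\langle\phi_{uu},N\rangle,\langle\phi_{vv},N\rangle$ of the second fundamental form (the mixed coefficients vanish), and $\kappa_1=e/E$, $\kappa_2=g/G$ are the principal curvatures. Subscripts $u,v$ denote partial derivatives. The direction vector, making a constant angle with the tangent plane of $S$ at $p$, is $$v_{\alpha,\beta}=\cos\alpha\cos\beta\,\frac{\phi_u}{\|\phi_u\|}+\cos\alpha\sin\beta\,\frac{\phi_v}{\|\phi_v\|}+\sin\alpha\,N,$$ and $r:U\to\mathbb{R}$ is a real-valued function locating the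 point on the line. The derivatives of the family $Q:\mathbb{R}^3\times U\to\mathbb{R}^3$ (computed without differentiating $r$) are $Q_u=b_{11}\phi_u+b_{12}\phi_v+b_{13}N$ and $Q_v=b_{21}\phi_u+b_{22}\phi_v+b_{23}N$, with $$b_{11}=-1-r\Big(\tfrac{\cos\alpha\sin\beta\,E_v}{2E\sqrt G}-\sin\alpha\,\kappa_1\Big),\quad b_{12}=\tfrac{r\cos\alpha\cos\beta\,E_v}{2G\sqrt E},\quad b_{13}=-\tfrac{r\cos\alpha\cos\beta\,e}{\sqrt E},$$ $$b_{21}=\tfrac{r\cos\alpha\sin\beta\,G_u}{2E\sqrt G},\quad b_{22}=-1-r\Big(\tfrac{\cos\alpha\cos\beta\,G_u}{2G\sqrt E}-\sin\alpha\,\kappa_2\Big),\quad b_{23}=-\tfrac{r\cos\alpha\sin\beta\,g}{\sqrt G}.$$ The envelope of $Q$ is said to have a solution (a point corresponding to $p$) when the matrix $J_{\alpha,\beta}=(b_{ij})_{2\times3}$ has rank less than $2$. Generically, the denominators in the two expressions for $r$ are nonzero, and this is assumed.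
   Formalization: The angle β may be any real number except integer multiples of π/2 other than 0 and π/2; at those excluded angles (for example β = π) the envelope can also have a solution, so the equivalence fails as literally stated. *)

(* Defs.v *)
From HB Require Import structures.
From mathcomp Require Import all_boot all_order all_algebra.
From mathcomp Require Import all_classical all_reals all_analysis.

Set Implicit Arguments.
Unset Strict Implicit.
Unset Printing Implicit Defensive.

Import Order.TTheory GRing.Theory Num.Theory.
Import numFieldNormedType.Exports.

Local Open Scope classical_set_scope.
Local Open Scope ring_scope.

Section Calculus.
Context {R : realType}.

Definition pdu {V : normedModType R} (f : R * R -> V) (p : R * R) : V :=
  'D_((1, 0) : R * R) f p.
Definition pdv {V : normedModType R} (f : R * R -> V) (p : R * R) : V :=
  'D_((0, 1) : R * R) f p.

Fixpoint Ck {V : normedModType R} (k : nat) (U : set (R * R))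
    (f : R * R -> V) : Prop :=
  (forall p, U p -> {for p, continuous f}) /\
  if k is k'.+1 then
    [/\ forall p, U p -> derivable f p ((1, 0) : R * R),
        forall p, U p -> derivable f p ((0, 1) : R * R),
        Ck k' U (pdu f) & Ck k' U (pdv f)]
  else True.

Definition smooth2_on {V : normedModType R} (U : set (R * R))
    (f : R * R -> V) : Prop := forall k, Ck k U f.

Definition dot3 (x y : 'rV[R]_3) : R := \sum_(i < 3) x 0 i * y 0 i.

(* The library norm on 'rV[R]_3 is the sup norm. *)
Definition enorm (x : 'rV[R]_3) : R := Num.sqrt (dot3 x x).

End Calculus.

Section Surfaces.
Context {R : realType}.
Implicit Types (S : set 'rV[R]_3) (U : set (R * R)).
Implicit Types (phi N : R * R -> 'rV[R]_3) (p : R * R).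

Record local_parametrization S U phi : Prop := LocalParametrization {
  param_open : open U;
  param_smooth : smooth2_on U phi;
  param_image : exists2 W : set 'rV[R]_3, open W & phi @` U = S `&` W;
  param_homeo : exists2 psi : 'rV[R]_3 -> R * R,
    {within phi @` U, continuous psi} & forall p, U p -> psi (phi p) = p;
  param_regular : forall p, U p -> row_free (col_mx (pdu phi p) (pdv phi p))
}.

Definition regular_surface S : Prop :=
  forall x, S x -> exists (U : set (R * R)) (phi : R * R -> 'rV[R]_3),
    local_parametrization S U phi /\ (phi @` U) x.

(* N p is the unit normal at the point phi p; either orientation is allowed. *)
Definition unit_normal U phi N : Prop :=
  smooth2_on U N /\
  forall p, U p -> [/\ dot3 (N p) (N p) = 1,
    dot3 (N p) (pdu phi p) = 0 & dot3 (N p) (pdv phi p) = 0].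

Definition fundE phi p : R := dot3 (pdu phi p) (pdu phi p).
Definition fundF phi p : R := dot3 (pdu phi p) (pdv phi p).
Definition fundG phi p : R := dot3 (pdv phi p) (pdv phi p).

Definition funde phi N p : R := dot3 (pdu (pdu phi) p) (N p).
Definition fundf phi N p : R := dot3 (pdv (pdu phi) p) (N p).
Definition fundg phi N p : R := dot3 (pdv (pdv phi) p) (N p).

Definition gauss_curvature phi N p : R :=
  (funde phi N p * fundg phi N p - fundf phi N p ^+ 2) /
  (fundE phi p * fundG phi p - fundF phi p ^+ 2).

Definition parabolic phi N p : Prop := gauss_curvature phi N p = 0.

Definition tangent_map (f : R * R -> 'rV[R]_3) p (w : R * R) : 'rV[R]_3 :=
  w.1 *: pdu f p + w.2 *: pdv f p.

(* The shape operator sends dphi(w) to - dN(w); principal directions and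
   curvatures are its eigenvectors and eigenvalues. *)
Definition principal phi N p (w : R * R) (k : R) : Prop :=
  w != 0 /\ - tangent_map N p w = k *: tangent_map phi p w.

Definition principal_direction phi N p (w : R * R) : Prop :=
  exists k, principal phi N p w k.

Definition principal_curvature phi N p (k : R) : Prop :=
  exists w, principal phi N p w k.

Definition umbilic phi N p : Prop :=
  forall k l, principal_curvature phi N p k -> principal_curvature phi N p l ->
  k = l.

Definition curvature_line_coordinates U phi N : Prop :=
  forall p, U p ->
    principal_direction phi N p (1, 0) /\ principal_direction phi N p (0, 1).

(* These are the principal curvatures in curvature line coordinates. *)
Definition kappa1 phi N p : R := funde phi N p / fundE phi p.
Definition kappa2 phi N p : R := fundg phi N p / fundG phi p.

End Surfaces.

Section Envelope.
Context {R : realType}.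
Implicit Types (phi N : R * R -> 'rV[R]_3) (alpha beta : R) (p : R * R).

Definition line_direction phi N alpha beta p : 'rV[R]_3 :=
  (cos alpha * cos beta / enorm (pdu phi p)) *: pdu phi p +
  (cos alpha * sin beta / enorm (pdv phi p)) *: pdv phi p +
  sin alpha *: N p.

Definition lineQ phi N alpha beta (rho : R) (X : 'rV[R]_3) p : 'rV[R]_3 :=
  X - phi p - rho *: line_direction phi N alpha beta p.

Definition moving_frame phi N p : 'M[R]_3 :=
  col_mx (col_mx (pdu phi p) (pdv phi p)) (N p).

(* The 2 x 3 matrix whose rows are the coordinates of Q_u and Q_v in the basis
   (phi_u, phi_v, N).  The function r is not differentiated: rho is a constant,
   replaced by r p only after taking the derivatives. *)
Definition envelopeJ phi N alpha beta (rho : R) (X : 'rV[R]_3) p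
    : 'M[R]_(2, 3) :=
  col_mx (pdu (lineQ phi N alpha beta rho X) p)
         (pdv (lineQ phi N alpha beta rho X) p) *m invmx (moving_frame phi N p).

Definition envelope_has_solution phi N alpha beta (r : R * R -> R) p : Prop :=
  exists X : 'rV[R]_3, lineQ phi N alpha beta (r p) X p = 0 /\
    (\rank (envelopeJ phi N alpha beta (r p) X p) < 2)%N.

End Envelope.

(* Main.v *)
Require Import Defs.
From HB Require Import structures.
From mathcomp Require Import all_boot all_order all_algebra.
From mathcomp Require Import all_classical all_reals all_analysis.
From mathcomp Require Import ring zify.

Set Implicit Arguments.
Unset Strict Implicit.
Unset Printing Implicit Defensive.

Import Order.TTheory GRing.Theory Num.Theory.
Import numFieldNormedType.Exports.

Local Open Scope classical_set_scope.
Local Open Scope ring_scope.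

(** The envelope equations compare an orthonormal moving frame with its own
derivatives, and in that frame they decouple.

Let X = phi_u / |phi_u|, Y = phi_v / |phi_v|, and write a = |phi_u|,
b = |phi_v|.  In coordinates along lines of curvature without umbilics,
symmetry of the second derivatives of phi (lemma [mixed_derivatives]) makes the
shape operator symmetric, so phi_u and phi_v, being eigenvectors for the
different eigenvalues kappa_1 and kappa_2, are orthogonal ([fundF_eq0]), and
(X, Y, N) is an orthonormal frame on the whole coordinate patch.
Differentiating the six constant dot products of the frame gives all its
derivatives up to the two numbers w = <X_u, Y> = - E_v / (2ab) and
t = - <Y_v, X> = G_u / (2ab) ([derive_frame_combination]), with no need to know
the derivatives of the normalising factors.  The direction of the line has
constant coordinates in this frame, so Q_u and Q_v are explicit.

The matrix J has rank less than 2 exactly when some nontrivial combination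
x Q_u + y Q_v vanishes ([rank_col_mx_lt2], [envelope_pencil]).  If neither
cos(beta) nor sin(beta) is 0, the N-component of that equation determines
x : y, and then the X- and Y-components, suitably scaled, add up to
(kappa_1 - kappa_2) a b = 0, which is excluded.  If sin(beta) = 0, the
N-component forces x = 0, since kappa_1 is nonzero at a nonparabolic point; what
is left is that the Y-component of Q_v vanishes, a linear equation for r.  The
case cos(beta) = 0 is symmetric ([degenerate_pencil]).  Solving the linear
equations gives the two formulas ([radius_formula]), and beta = 0, beta = pi/2
are the only multiples of pi/2 that the range of beta allows. *)

(** * Derivatives along a direction *)

Section DirectionalCalculus.
Context {R : realType} {V : normedModType R}.
Implicit Types (f g : V -> 'rV[R]_3) (s : V -> R) (q v : V).

Lemma is_derive_coord f q v (df : 'rV[R]_3) i j :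
  is_derive q v f df -> is_derive q v (fun x => f x i j) (df i j).
Proof.
move=> [dv <-]; split; first by have /derivable_mxP := dv; exact.
by rewrite derive_mx // mxE.
Qed.

Lemma is_derive_rV f q v (df : 'rV[R]_3) :
  (forall i j, is_derive q v (fun x => f x i j) (df i j)) ->
  is_derive q v f df.
Proof.
move=> fij.
have dv : derivable f q v.
  by apply/derivable_mxP => i j; have [] := fij i j.
split=> //; apply/matrixP => i j; rewrite derive_mx // mxE.
by have [] := fij i j.
Qed.

Lemma is_derive_dot3 f g q v (df dg : 'rV[R]_3) :
  is_derive q v f df -> is_derive q v g dg ->
  is_derive q v (fun x => dot3 (f x) (g x)) (dot3 df (g q) + dot3 (f q) dg).
Proof.
move=> fd gd.
have -> : (fun x => dot3 (f x) (g x)) =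
    \sum_(i < 3) ((fun x => f x 0 i) * (fun x => g x 0 i)).
  by apply/funext => x; rewrite fct_sumE.
rewrite /dot3 -big_split /=; apply: is_derive_sum => i.
apply: (is_derive_eq (is_deriveM (is_derive_coord 0 i fd)
                                 (is_derive_coord 0 i gd))).
by rewrite addrC; congr (_ + _); rewrite mulrC.
Qed.

Lemma is_derive_scale s f q v (ds : R) (df : 'rV[R]_3) :
  is_derive q v s ds -> is_derive q v f df ->
  is_derive q v (fun x => s x *: f x) (ds *: f q + s q *: df).
Proof.
move=> sd fd; apply: is_derive_rV => i j.
have -> : (fun x => (s x *: f x) i j) = s * (fun x => f x i j).
  by apply/funext => x; rewrite mxE.
apply: (is_derive_eq (is_deriveM sd (is_derive_coord i j fd))).
by rewrite !mxE addrC; congr (_ + _); rewrite mulrC.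
Qed.

(** On the line through [q] along [v], [s] is a differentiable function of one
real variable, to which the chain rule applies. *)
Lemma derivable_sqrt s q v :
  0 < s q -> derivable s q v -> derivable (fun x => Num.sqrt (s x)) q v.
Proof.
move=> s0 /derivable1P/derivable1_diffP sd.
apply/derivable1P/derivable1_diffP.
apply: (@differentiable_comp _ _ _ _
  (fun h : R => s (h *: v + q)) Num.sqrt) => //.
rewrite scale0r add0r; apply/derivable1_diffP.
by have [] := is_derive1_sqrt s0.
Qed.

Lemma MVT_line s ds q v (h : R) : 0 < h ->
  (forall t, 0 <= t <= h -> is_derive (t *: v + q) v s (ds (t *: v + q))) ->
  exists2 t, 0 < t < h & s (h *: v + q) - s q = h * ds (t *: v + q).
Proof.
move=> h0 sd; pose S (t : R) := s (t *: v + q).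
have Sd (t : R) : 0 <= t <= h -> is_derive t 1 S (ds (t *: v + q)).
  move=> /sd [dv dE].
  (* the two derivatives are limits of the same difference quotient *)
  suff SE : (fun k => k^-1 *: ((S \o shift t) (k *: 1) - S t)) =
      (fun k => k^-1 *: ((s \o shift (t *: v + q)) (k *: v) -
                         s (t *: v + q))).
    by split; [rewrite /derivable SE|rewrite /derive SE].
  by apply/funext => k; rewrite /S /= [k%:A]mulr1 scalerDl addrA.
have [||t t0h] := @MVT R S (fun t => ds (t *: v + q)) 0 h h0.
- by move=> t; rewrite in_itv /= => /andP[t0 th]; apply: Sd; rewrite !ltW.
- apply: derivable_within_continuous => t; rewrite in_itv /= => th.
  by have [] := Sd t th.
rewrite /S scale0r add0r subr0 => SE; exists t; first by move: t0h; rewrite in_itv.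
by rewrite SE mulrC.
Qed.

(** The second difference of [s] on a parallelogram is a mixed derivative at
some point inside: the mean value theorem along [u], applied to the increment of
[s] in the direction [v], and then along [v].  Exchanging [u] and [v] leaves the
left-hand side unchanged, which is what makes mixed derivatives agree. *)
Lemma second_difference s su suv q u v (h : R) : 0 < h ->
  (forall c d, 0 <= c <= h -> 0 <= d <= h ->
     is_derive (c *: u + (d *: v + q)) u s (su (c *: u + (d *: v + q)))) ->
  (forall c d, 0 <= c <= h -> 0 <= d <= h ->
     is_derive (c *: u + (d *: v + q)) v su (suv (c *: u + (d *: v + q)))) ->
  exists c d, [/\ 0 <= c <= h, 0 <= d <= h &
    s (h *: u + (h *: v + q)) - s (h *: v + q) - (s (h *: u + q) - s q) =
    h * (h * suv (c *: u + (d *: v + q)))].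
Proof.
move=> h0 sd sud; pose D x := s (h *: v + x) - s x.
have hh : 0 <= h <= h by rewrite ltW /=.
have zh : 0 <= (0 : R) <= h by rewrite lexx ltW.
have shift_derive x y du : is_derive (x + y) u s du ->
    is_derive y u (fun z => s (x + z)) du.
  move=> [dv dE].
  suff SE : (fun k => k^-1 *:
      (((fun z => s (x + z)) \o shift y) (k *: u) - s (x + y))) =
      (fun k => k^-1 *: ((s \o shift (x + y)) (k *: u) - s (x + y))).
    by split; [rewrite /derivable SE|rewrite /derive SE].
  by apply/funext => k /=; rewrite addrCA.
have [|c c0h DE] := @MVT_line D (fun x => su (h *: v + x) - su x) q u h h0.
- move=> t th; apply: is_deriveB.
    by apply: shift_derive; rewrite addrCA; exact: sd.
  by have := sd t 0 th zh; rewrite scale0r add0r.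
have ch : 0 <= c <= h by case/andP: c0h => ? ?; rewrite !ltW.
have [|d d0h SE] := @MVT_line su suv (c *: u + q) v h h0.
- by move=> t th; rewrite addrCA; exact: sud.
exists c, d; split=> //; first by case/andP: d0h => ? ?; rewrite !ltW.
rewrite [_ *: u + (d *: _ + _)]addrCA -SE -DE /D.
by rewrite [_ *: u + (h *: v + _)]addrCA opprB addrACA [RHS]addrC !addrA; ring.
Qed.

Lemma near_parallelogram (P : set V) q u v : nbhs q P ->
  exists2 h : R, 0 < h & forall c d, 0 <= c <= h -> 0 <= d <= h ->
    P (c *: u + (d *: v + q)).
Proof.
move=> /nbhs_ballP[e /= e0 eP]; pose m := `|u| + `|v| + 1.
have m0 : 0 < m by rewrite ltr_wpDl.
exists (e / m); first by rewrite divr_gt0.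
move=> c d /andP[c0 ch] /andP[d0 dh]; apply: eP.
rewrite -ball_normE /ball_ /= addrA opprD addrCA subrr addr0 normrN.
apply: (le_lt_trans (ler_normD _ _)); rewrite !normrZ !ger0_norm //.
apply: (@le_lt_trans _ _ (e / m * `|u| + e / m * `|v|)).
  by rewrite lerD // ler_wpM2r.
have -> : e = e / m * m by rewrite divfK // gt_eqF.
rewrite mulfK ?gt_eqF // -mulrDr ltr_pM2l ?divr_gt0 //.
by rewrite /m ltrDl.
Qed.

(** Symmetry of second derivatives: on a small parallelogram at [p] the second
difference is h^2 times a value of either mixed derivative at a point near [p],
and both are continuous at [p]. *)
Lemma mixed_derivatives (U : set V) s su sv suv svu p u v :
  open U -> U p ->
  (forall q, U q -> is_derive q u s (su q)) ->
  (forall q, U q -> is_derive q v s (sv q)) ->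
  (forall q, U q -> is_derive q v su (suv q)) ->
  (forall q, U q -> is_derive q u sv (svu q)) ->
  {for p, continuous suv} -> {for p, continuous svu} ->
  suv p = svu p.
Proof.
move=> Uo Up sud svd suvd svud cuv cvu.
apply/eqP; rewrite -subr_eq0 -normr_eq0 eq_le normr_ge0 andbT.
apply/ler_addgt0Pl => _ /posnumP[e]; rewrite addr0.
have near_p : nbhs p [set q | [/\ U q, `|suv p - suv q| < e%:num / 2 &
                                 `|svu p - svu q| < e%:num / 2]].
  have e2 : 0 < e%:num / 2 by [].
  have Un := open_nbhs_nbhs (conj Uo Up).
  have /cvgrPdist_lt/(_ _ e2) := cuv; have /cvgrPdist_lt/(_ _ e2) := cvu.
  move: Un; apply: filterS3 => q; by split.
have [h h0 Ph] := near_parallelogram u v near_p.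
have [||c [d [ch dh E1]]] := @second_difference s su suv p u v h h0.
- by move=> c d ch dh; apply: sud; have [] := Ph _ _ ch dh.
- by move=> c d ch dh; apply: suvd; have [] := Ph _ _ ch dh.
have [||d' [c' [dh' ch' E2]]] := @second_difference s sv svu p v u h h0.
- by move=> x y xh yh; apply: svd; rewrite addrCA; have [] := Ph _ _ yh xh.
- by move=> x y xh yh; apply: svud; rewrite addrCA; have [] := Ph _ _ yh xh.
have E : suv (c *: u + (d *: v + p)) = svu (d' *: v + (c' *: u + p)).
  do 2! apply: (mulfI (lt0r_neq0 h0)).
  by rewrite -E1 -E2 [h *: v + (h *: u + p)]addrCA; ring.
have [_ A _] := Ph _ _ ch dh; have [_ _ B] := Ph _ _ ch' dh'.
rewrite E in A; rewrite [c' *: u + _]addrCA in B.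
rewrite (splitr e%:num) -(subrKA (svu (d' *: v + (c' *: u + p)))).
by rewrite (le_trans (ler_normD _ _))// lerD ?ltW // distrC.
Qed.

End DirectionalCalculus.

(** * Dot products, frames and rank *)

Section LinearAlgebra.
Context {R : realType}.
Implicit Types (x y z w : 'rV[R]_3).

Lemma dot3C x y : dot3 x y = dot3 y x.
Proof. by apply: eq_bigr => i _; rewrite mulrC. Qed.

Lemma dot3E x y : x *m y^T = (dot3 x y)%:M.
Proof.
apply/matrixP => i j; rewrite !ord1 !mxE /= mulr1n.
by apply: eq_bigr => k _; rewrite mxE.
Qed.

Lemma dot3Dl x y z : dot3 (x + y) z = dot3 x z + dot3 y z.
Proof. by rewrite -big_split; apply: eq_bigr => i _; rewrite mxE mulrDl. Qed.

Lemma dot3Zl (a : R) x y : dot3 (a *: x) y = a * dot3 x y.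
Proof.
by rewrite /dot3 big_distrr; apply: eq_bigr => i _ /=; rewrite mxE mulrA.
Qed.

Lemma dot3Nl x y : dot3 (- x) y = - dot3 x y.
Proof. by rewrite -scaleN1r dot3Zl mulN1r. Qed.

Lemma dot3Zr (a : R) x y : dot3 x (a *: y) = a * dot3 x y.
Proof. by rewrite dot3C dot3Zl dot3C. Qed.

Lemma dot30l x : dot3 0 x = 0.
Proof. by rewrite -[0](scale0r 0) dot3Zl mul0r. Qed.

Lemma dot3_gt0 x : x != 0 -> 0 < dot3 x x.
Proof.
move=> x0; rewrite lt_neqAle sumr_ge0 ?andbT; last by move=> i _; exact: sqr_ge0.
apply: contraNneq x0 => /esym/eqP.
rewrite psumr_eq0; last by move=> i _; exact: sqr_ge0.
move=> /allP x0; apply/eqP/rowP => i; rewrite mxE.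
by have := x0 i (mem_index_enum i); rewrite mulf_eq0 orbb => /eqP.
Qed.

Lemma enorm_sqr x : dot3 x x = enorm x ^+ 2.
Proof. by rewrite sqr_sqrtr // sumr_ge0 // => i _; exact: sqr_ge0. Qed.

Lemma enorm_neq0 x : x != 0 -> enorm x != 0.
Proof. by move=> x0; rewrite gt_eqF // sqrtr_gt0 dot3_gt0. Qed.

(** The same block shape as [moving_frame], so that facts about arbitrary
orthogonal vectors apply to it by conversion. *)
Definition frame x y z : 'M[R]_3 := col_mx (col_mx x y) z.

Lemma frame_dual x y z x' y' z' :
  dot3 x x' = 1 -> dot3 x y' = 0 -> dot3 x z' = 0 ->
  dot3 y x' = 0 -> dot3 y y' = 1 -> dot3 y z' = 0 ->
  dot3 z x' = 0 -> dot3 z y' = 0 -> dot3 z z' = 1 ->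
  frame x y z *m (frame x' y' z')^T = 1%:M.
Proof.
move=> xx xy xz yx yy yz zx zy zz.
have := mul_col_row (col_mx x y) z (col_mx x' y')^T z'^T.
rewrite -tr_col_mx => H; apply: (etrans H) => {H}.
rewrite !tr_col_mx !mul_col_mx !mul_mx_row !dot3E.
rewrite xx xy xz yx yy yz zx zy zz.
rewrite -[col_mx (row_mx _ _) _]/(block_mx _ _ _ _) !raddf0 row_mx0 col_mx0.
by rewrite -!scalar_mx_block.
Qed.

(** The inverse is explicit: its columns are the dual frame x / |x|^2,
y / |y|^2, z. *)
Lemma orthogonal_frame_unit x y z : x != 0 -> y != 0 ->
  dot3 x y = 0 -> dot3 x z = 0 -> dot3 y z = 0 -> dot3 z z = 1 ->
  frame x y z \in unitmx.
Proof.
move=> /dot3_gt0/lt0r_neq0 x0 /dot3_gt0/lt0r_neq0 y0 xy xz yz zz.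
have := @frame_dual x y z ((dot3 x x)^-1 *: x) ((dot3 y y)^-1 *: y) z.
rewrite !dot3Zr !(dot3C z) (dot3C y x) xy xz yz !mulr0 !mulVf // zz => dual.
by have [] := mulmx1_unit
  (dual erefl erefl erefl erefl erefl erefl erefl erefl erefl).
Qed.

Lemma frame_separates x y z w : frame x y z \in unitmx ->
  w = 0 <-> [/\ dot3 w x = 0, dot3 w y = 0 & dot3 w z = 0].
Proof.
move=> Fu; split=> [->|[wx wy wz]]; first by rewrite !dot30l.
apply: trmx_inj; rewrite raddf0 -[LHS](mulKmx Fu).
suff -> : frame x y z *m w^T = 0 by rewrite mulmx0.
rewrite dot3C in wx; rewrite dot3C in wy; rewrite dot3C in wz.
by rewrite (mul_col_mx (col_mx x y) z) mul_col_mx !dot3E wx wy wz !raddf0 !col_mx0.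
Qed.

Lemma rank_col_mx_lt2 x y : (\rank (col_mx x y) < 2)%N <->
  exists a b : R, (a != 0 \/ b != 0) /\ a *: x + b *: y = 0.
Proof.
have mulE (w : 'rV[R]_(1 + 1)) :
    w *m col_mx x y = lsubmx w 0 0 *: x + rsubmx w 0 0 *: y.
  rewrite -[in LHS](hsubmxK w) mul_row_col [lsubmx w]mx11_scalar.
  by rewrite [rsubmx w]mx11_scalar !mul_scalar_mx !mxE /= !mulr1n.
split=> [|[a [b [ab0 E]]]].
  rewrite ltn_neqAle rank_leq_row andbT -/(row_free _) -kermx_eq0.
  case/rowV0Pn => w /sub_kermxP wK w0.
  exists (lsubmx w 0 0), (rsubmx w 0 0); rewrite -mulE; split=> //.
  have [l0|] := eqVneq (lsubmx w 0 0) 0; last by left.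
  right; apply: contraNneq w0 => r0; rewrite -(hsubmxK w).
  by rewrite [lsubmx w]mx11_scalar [rsubmx w]mx11_scalar l0 r0 !raddf0 row_mx0.
rewrite ltn_neqAle rank_leq_row andbT -/(row_free _) -kermx_eq0.
apply/rowV0Pn; exists (row_mx a%:M b%:M : 'rV_(1 + 1)).
  by apply/sub_kermxP; rewrite mul_row_col !mul_scalar_mx.
apply/negP => /eqP; rewrite -(row_mx0 R 1 1 1) => /eq_row_mx[a0 b0].
case: ab0 => /eqP; apply.
  by have := congr1 (fun M : 'M[R]_1 => M 0 0) a0; rewrite !mxE eqxx.
by have := congr1 (fun M : 'M[R]_1 => M 0 0) b0; rewrite !mxE eqxx.
Qed.

End LinearAlgebra.

(** * Zeros of sine and cosine *)

Section Trigonometry.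
Context {R : realType}.

Lemma sin_int_pi (n : int) : sin (n%:~R * pi : R) = 0.
Proof.
have nat_case (m : nat) : sin (m%:R * pi : R) = 0.
  elim: m => [|m IHm]; first by rewrite mul0r sin0.
  by rewrite -natr1 mulrDl mul1r sinDpi IHm oppr0.
by case: n => m; rewrite ?NegzE ?mulrNz ?mulNr ?sinN nat_case ?oppr0.
Qed.

(** Subtracting the multiple of pi below x leaves a number in [0, pi[, and
sine is positive on ]0, pi[. *)
Lemma sin_eq0 (x : R) : sin x = 0 -> exists n : int, x = n%:~R * pi.
Proof.
move=> sx; exists (Num.floor (x / pi)); set n := Num.floor _.
have pi0 := pi_gt0 R.
have /andP[nx xn] : n%:~R <= x / pi < (n + 1)%:~R by exact: floor_itv.
have y0 : 0 <= x - n%:~R * pi by rewrite subr_ge0 -ler_pdivlMr.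
have ypi : x - n%:~R * pi < pi.
  by rewrite ltrBlDr -[X in X + _]mul1r -mulrDl -ltr_pdivrMr // addrC -intrD1.
move: y0; rewrite le_eqVlt => /orP[/eqP/esym/eqP|y0].
  by rewrite subr_eq0 => /eqP.
have : 0 < sin (x - n%:~R * pi) by apply: sin_gt0_pi; rewrite y0.
by rewrite sinB sx sin_int_pi mul0r mulr0 subr0 ltxx.
Qed.

Lemma cos_eq0 (x : R) : cos x = 0 -> exists n : int, x = n%:~R * pi - pi / 2.
Proof.
by rewrite -sinDpihalf => /sin_eq0[n nE]; exists n; rewrite -nE addrK.
Qed.

End Trigonometry.

(** * The algebra of the rank condition *)

(** The three equations say that x Q_u + y Q_v = 0, component by component in the
orthonormal frame (X, Y, N); cb and sb are the cosine and sine of beta.  The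
third equation fixes x : y unless cb or sb vanishes.  When neither does, [f1]
and [f2] below are the first two equations with y eliminated and the common
factors removed, and their sum is (k1 - k2) a b = 0. *)
Lemma degenerate_pencil (R : realFieldType)
    (a b c s k1 k2 cb sb rho w t : R) :
  a != 0 -> b != 0 -> c != 0 -> k1 != 0 -> k2 != 0 -> k1 != k2 ->
  cb ^+ 2 + sb ^+ 2 = 1 ->
  (exists x y : R, [/\ x != 0 \/ y != 0,
     x * (- a + rho * (c * sb * w + s * k1 * a)) + y * (rho * (c * sb * t)) = 0,
     x * - (rho * (c * cb * w)) +
       y * (- b + rho * (- (c * cb * t) + s * k2 * b)) = 0
   & x * - (rho * (c * cb * k1 * a)) + y * - (rho * (c * sb * k2 * b)) = 0]) <->
  (sb = 0 /\ b = rho * (- (c * cb * t) + s * k2 * b)) \/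
  (cb = 0 /\ a = rho * (c * sb * w + s * k1 * a)).
Proof.
move=> a0 b0 c0 k10 k20 k12 cs1; split; last first.
  case=> [[-> bE]|[-> aE]].
    exists 0, 1; split; [by right; exact: oner_neq0|ring| |ring].
    by rewrite -bE; ring.
  exists 1, 0; split; [by left; exact: oner_neq0| |ring|ring].
  by rewrite -aE; ring.
move=> [x [y [xy0 e1 e2 e3]]].
have [r0|r0] := eqVneq rho 0.
  (* at r = 0 the two rows are - a X and - b Y *)
  exfalso; move: e1 e2; rewrite r0 !mul0r oppr0 !mulr0 !addr0 add0r !mulrN.
  move=> /eqP; rewrite oppr_eq0 mulf_eq0 (negbTE a0) orbF => /eqP x0.
  move=> /eqP; rewrite oppr_eq0 mulf_eq0 (negbTE b0) orbF => /eqP y0.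
  by case: xy0; rewrite ?x0 ?y0 eqxx.
have e3' : x * (cb * k1 * a) + y * (sb * k2 * b) = 0.
  apply: (mulfI (mulf_neq0 r0 c0)); rewrite mulr0 -[RHS]oppr0 -e3; ring.
have [sb0|sb0] := eqVneq sb 0.
  left; split=> //.
  have cb0 : cb != 0.
    apply/eqP => cb0; move: cs1; rewrite cb0 sb0 expr0n addr0 => /eqP.
    by rewrite eq_sym oner_eq0.
  have x0 : x = 0.
    move: e3'; rewrite sb0 !mul0r mulr0 addr0 => /eqP.
    by rewrite !mulf_eq0 (negbTE cb0) (negbTE k10) (negbTE a0) !orbF => /eqP.
  have y0 : y != 0 by case: xy0 => //; rewrite x0 eqxx.
  apply: (mulfI y0); apply/eqP; rewrite -subr_eq0 -oppr_eq0; apply/eqP.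
  by rewrite -e2 x0; ring.
have [cb0|cb0] := eqVneq cb 0.
  right; split=> //.
  have y0 : y = 0.
    move: e3'; rewrite cb0 !mul0r mulr0 add0r => /eqP.
    by rewrite !mulf_eq0 (negbTE sb0) (negbTE k20) (negbTE b0) !orbF => /eqP.
  have x0 : x != 0 by case: xy0 => //; rewrite y0 eqxx.
  apply: (mulfI x0); apply/eqP; rewrite -subr_eq0 -oppr_eq0; apply/eqP.
  by rewrite -e1 y0; ring.
exfalso; have d0 : sb * k2 * b != 0 by rewrite !mulf_neq0.
have yE : y = - (x * (cb * k1 * a)) / (sb * k2 * b).
  by apply: (mulIf d0); rewrite divfK //; apply/eqP; rewrite -addr_eq0 addrC e3'.
have x0 : x != 0.
  apply/eqP => x0; case: xy0; rewrite ?yE ?x0 ?mul0r ?oppr0 ?mul0r eqxx //.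
have f1 : k2 * b * (- a + rho * (c * sb * w + s * k1 * a)) -
    cb * k1 * a * (rho * c * t) = 0.
  apply: (mulfI x0); rewrite mulr0.
  transitivity (k2 * b * (x * (- a + rho * (c * sb * w + s * k1 * a)) +
                        y * (rho * (c * sb * t)))); last by rewrite e1 mulr0.
  by rewrite yE; field; rewrite ?sb0 ?k20 ?b0.
have f2 : - (sb * k2 * b * rho * c * w) -
    k1 * a * (- b + rho * (- (c * cb * t) + s * k2 * b)) = 0.
  apply: (mulfI (mulf_neq0 x0 cb0)); rewrite mulr0.
  transitivity (sb * k2 * b * (x * - (rho * (c * cb * w)) +
    y * (- b + rho * (- (c * cb * t) + s * k2 * b)))); last by rewrite e2 mulr0.
  by rewrite yE; field; rewrite ?sb0 ?k20 ?b0.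
move/eqP: k12; apply; apply: (mulIf (mulf_neq0 a0 b0)).
apply/eqP; rewrite -subr_eq0 -(addr0 0) -[X in _ == X + _]f1 -[X in _ == _ + X]f2.
by apply/eqP; ring.
Qed.

(** * Differentiating an orthonormal frame *)

Lemma derive_dot3_const (R : realType) (V : normedModType R) (U : set V)
    (f g : V -> 'rV[R]_3) (p v : V) (df dg : 'rV[R]_3) (k : R) :
  open U -> U p -> (forall q, U q -> dot3 (f q) (g q) = k) ->
  is_derive p v f df -> is_derive p v g dg ->
  dot3 df (g p) = - dot3 (f p) dg.
Proof.
move=> Uo Up fgk fd gd; apply/eqP; rewrite -addr_eq0; apply/eqP.
have [_ <-] := is_derive_dot3 fd gd.
rewrite -(derive_cst k p v); apply: near_eq_derive.
by have := open_nbhs_nbhs (conj Uo Up); apply: filterS => q /fgk.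
Qed.

Section MovingFrame.
Context {R : realType} {V : normedModType R}.
Implicit Types (P Q N : V -> 'rV[R]_3).

(** The coefficient [d] is left unspecified: it disappears from every dot product
with a vector orthogonal to [P p], and the remaining one is fixed by the
constant length of the normalised field. *)
Lemma is_derive_normalize P p v dP : P p != 0 -> is_derive p v P dP ->
  exists d : R, is_derive p v (fun x => (enorm (P x))^-1 *: P x)
                  (d *: P p + (enorm (P p))^-1 *: dP).
Proof.
move=> /dot3_gt0 P0 Pd.
have nd : derivable (fun x => (enorm (P x))^-1) p v.
  apply: derivableV; first by rewrite gt_eqF // sqrtr_gt0.
  by apply: derivable_sqrt => //; have [] := is_derive_dot3 Pd Pd.
by eexists; exact: is_derive_scale (derivableP nd) Pd.
Qed.

(** The derivative, along a line of curvature tangent to [P], of a field with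
constant coordinates A, B, s in the frame (P/|P|, Q/|Q|, N).  The frame being
orthonormal, its derivative is antisymmetric: of the three independent entries,
[w] is the one between the tangent vectors, and the hypothesis on [dN] says that
the normal entry along [P] is k |P| and the one along [Q] vanishes.  The
statement is symmetric in the two tangent fields so that it also serves for the
other family of coordinate curves. *)
Lemma derive_frame_combination (U : set V) P Q N p v
    (dP dQ dN : 'rV[R]_3) (A B s k w : R) :
  open U -> U p ->
  (forall q, U q -> P q != 0) -> (forall q, U q -> Q q != 0) ->
  (forall q, U q -> dot3 (P q) (Q q) = 0) ->
  (forall q, U q -> dot3 (P q) (N q) = 0) ->
  (forall q, U q -> dot3 (Q q) (N q) = 0) ->
  is_derive p v P dP -> is_derive p v Q dQ -> is_derive p v N dN ->
  dN = - k *: P p -> dot3 dP (Q p) / (enorm (P p) * enorm (Q p)) = w ->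
  exists dL, [/\ is_derive p v (fun x => (A / enorm (P x)) *: P x +
                                 (B / enorm (Q x)) *: Q x + s *: N x) dL,
    dot3 dL (P p) = - enorm (P p) * (B * w + s * k * enorm (P p)),
    dot3 dL (Q p) = enorm (Q p) * (A * w)
  & dot3 dL (N p) = A * k * enorm (P p)].
Proof.
move=> Uo Up P0 Q0 PQ PN QN Pd Qd Nd dNE wE.
set a := enorm (P p) in wE *; set b := enorm (Q p) in wE *.
have a0 : a != 0 by exact/enorm_neq0/P0.
have b0 : b != 0 by exact/enorm_neq0/Q0.
have [d1 X1d] := is_derive_normalize (P0 _ Up) Pd.
have [d2 X2d] := is_derive_normalize (Q0 _ Up) Qd.
rewrite -/a in X1d; rewrite -/b in X2d.
set dX1 := (X in is_derive _ _ _ X) in X1d.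
set dX2 := (X in is_derive _ _ _ X) in X2d.
have unit (f : V -> 'rV[R]_3) : (forall q, U q -> f q != 0) -> forall q, U q ->
    dot3 ((enorm (f q))^-1 *: f q) ((enorm (f q))^-1 *: f q) = 1.
  move=> f0 q Uq; rewrite dot3Zl dot3Zr enorm_sqr.
  by field; exact/enorm_neq0/f0.
have dX1P : dot3 dX1 (P p) = 0.
  have := derive_dot3_const Uo Up (unit _ P0) X1d X1d.
  rewrite -/a dot3Zr dot3Zl (dot3C (P p)) => /eqP; rewrite -subr_eq0 opprK -mulr2n.
  by rewrite mulrn_eq0 mulf_eq0 invr_eq0 (negbTE a0) => /eqP.
have dX2Q : dot3 dX2 (Q p) = 0.
  have := derive_dot3_const Uo Up (unit _ Q0) X2d X2d.
  rewrite -/b dot3Zr dot3Zl (dot3C (Q p)) => /eqP; rewrite -subr_eq0 opprK -mulr2n.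
  by rewrite mulrn_eq0 mulf_eq0 invr_eq0 (negbTE b0) => /eqP.
have dX1Q : dot3 dX1 (Q p) = b * w.
  rewrite /dX1 dot3Dl !dot3Zl PQ // mulr0 add0r -wE.
  by field; rewrite a0 b0.
have dX2P : dot3 dX2 (P p) = - (a * w).
  have X12 q : U q -> dot3 ((enorm (P q))^-1 *: P q) ((enorm (Q q))^-1 *: Q q) = 0.
    by move=> Uq; rewrite dot3Zl dot3Zr PQ // !mulr0.
  have := derive_dot3_const Uo Up X12 X1d X2d.
  rewrite -/a -/b dot3Zl dot3Zr dX1Q (dot3C (P p)) mulKf // => X12E.
  by rewrite X12E mulrN opprK mulVKf.
have dX1N : dot3 dX1 (N p) = k * a.
  have X1N q : U q -> dot3 ((enorm (P q))^-1 *: P q) (N q) = 0.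
    by move=> Uq; rewrite dot3Zl PN // !mulr0.
  have -> := derive_dot3_const Uo Up X1N X1d Nd.
  by rewrite dNE dot3Zl dot3Zr enorm_sqr -/a; field.
have dX2N : dot3 dX2 (N p) = 0.
  have X2N q : U q -> dot3 ((enorm (Q q))^-1 *: Q q) (N q) = 0.
    by move=> Uq; rewrite dot3Zl QN // !mulr0.
  have -> := derive_dot3_const Uo Up X2N X2d Nd.
  by rewrite dNE dot3Zl dot3Zr (dot3C (Q p)) PQ // !mulr0 oppr0.
exists (A *: dX1 + B *: dX2 + s *: dN); split.
- have Ld := is_deriveD (is_deriveD (is_deriveZ A X1d) (is_deriveZ B X2d))
               (is_deriveZ s Nd).
  congr is_derive: Ld.
  by apply/funext => x; rewrite -!scalerA.
- rewrite !dot3Dl !dot3Zl dX1P dX2P dNE dot3Zl enorm_sqr -/a; ring.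
- rewrite !dot3Dl !dot3Zl dX1Q dX2Q dNE dot3Zl PQ //; ring.
- rewrite !dot3Dl !dot3Zl dX1N dX2N dNE dot3Zl PN //; ring.
Qed.

End MovingFrame.

(** * Smooth maps of two variables *)

Section SmoothMaps.
Context {R : realType}.
Implicit Types (U : set (R * R)) (f : R * R -> 'rV[R]_3).

Lemma smooth2_pdu U f : smooth2_on U f -> smooth2_on U (pdu f).
Proof. by move=> fs k; case: (fs k.+1) => _ [_ _ uk _]; exact: uk. Qed.

Lemma smooth2_pdv U f : smooth2_on U f -> smooth2_on U (pdv f).
Proof. by move=> fs k; case: (fs k.+1) => _ [_ _ _ vk]; exact: vk. Qed.

Lemma smooth2_continuous U f p : smooth2_on U f -> U p -> {for p, continuous f}.
Proof. by move=> fs Up; have [fc _] := fs 0%N; exact: fc. Qed.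

Lemma smooth2_is_derive_u U f p : smooth2_on U f -> U p ->
  is_derive p ((1, 0) : R * R) f (pdu f p).
Proof. by move=> fs Up; have [_ [fd _ _ _]] := fs 1%N; exact/derivableP/fd. Qed.

Lemma smooth2_is_derive_v U f p : smooth2_on U f -> U p ->
  is_derive p ((0, 1) : R * R) f (pdv f p).
Proof. by move=> fs Up; have [_ [_ fd _ _]] := fs 1%N; exact/derivableP/fd. Qed.

Lemma continuous_coord f p i j :
  {for p, continuous f} -> {for p, continuous (fun q => f q i j)}.
Proof.
move=> fc; apply: (@continuous_comp _ _ _ f (fun M : 'rV[R]_3 => M i j)) => //.
exact: coord_continuous.
Qed.

Lemma pdv_pdu U f p : open U -> smooth2_on U f -> U p ->
  pdv (pdu f) p = pdu (pdv f) p.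
Proof.
move=> Uo fs Up; have us := smooth2_pdu fs; have vs := smooth2_pdv fs.
apply/matrixP => i j.
apply: (@mixed_derivatives _ _ U (fun q => f q i j) (fun q => pdu f q i j)
  (fun q => pdv f q i j) (fun q => pdv (pdu f) q i j)
  (fun q => pdu (pdv f) q i j) p (1, 0) (0, 1)) => // [q Uq|q Uq|q Uq|q Uq| |].
- exact/is_derive_coord/(smooth2_is_derive_u fs).
- exact/is_derive_coord/(smooth2_is_derive_v fs).
- exact/is_derive_coord/(smooth2_is_derive_v us).
- exact/is_derive_coord/(smooth2_is_derive_u vs).
- exact/continuous_coord/(smooth2_continuous (smooth2_pdv us)).
- exact/continuous_coord/(smooth2_continuous (smooth2_pdu vs)).
Qed.

Lemma tangent_map_u f p : tangent_map f p (1, 0) = pdu f p.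
Proof. by rewrite /tangent_map scale1r scale0r addr0. Qed.

Lemma tangent_map_v f p : tangent_map f p (0, 1) = pdv f p.
Proof. by rewrite /tangent_map scale1r scale0r add0r. Qed.

End SmoothMaps.

(** * Pointwise identities between vectors *)

Section VectorIdentities.
Context {R : realType}.
Implicit Types (x y nu nv : 'rV[R]_3) (k l : R).

(** If w1 x + w2 y is an eigenvector for l of a map equal to k on x and y, then
k = l as soon as x and y are independent: this is the relation to which
independence applies. *)
Lemma eigen_combination x y (w1 w2 : R) k l :
  - (w1 *: (- k *: x) + w2 *: (- k *: y)) = l *: (w1 *: x + w2 *: y) ->
  ((k - l) * w1) *: x + ((k - l) * w2) *: y = 0.
Proof.
move=> E; apply/rowP => i; have := congr1 (fun z : 'rV[R]_3 => z 0 i) E.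
by rewrite !mxE => /eqP; rewrite -subr_eq0 => /eqP <-; ring.
Qed.

Lemma addr_swap x y nu : x + y + nu = y + x + nu.
Proof. by rewrite (addrC x). Qed.

Lemma half_quotient (m a b : R) : a != 0 -> b != 0 ->
  - (m / 2) / (a * b) = - (m / (2 * b * a)).
Proof. by move=> a0 b0; field; rewrite a0 b0. Qed.

(** Eigenvectors of a symmetric operator for distinct eigenvalues are
orthogonal; symmetry enters through the common value [f]. *)
Lemma orthogonal_of_symmetric x y nu nv k l (f : R) : k != l ->
  nu = - k *: x -> nv = - l *: y -> dot3 nu y = f -> dot3 nv x = f ->
  dot3 x y = 0.
Proof.
move=> kl -> ->; rewrite !dot3Zl (dot3C y) => <- /eqP.
rewrite -subr_eq0 -mulrBl mulf_eq0 opprK addrC subr_eq0 (negbTE kl).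
by move/eqP.
Qed.

Lemma normal_curvature_eigenvalue x nu k (e : R) : x != 0 ->
  nu = - k *: x -> e = - dot3 x nu -> e / dot3 x x = k.
Proof.
move=> x0 -> ->; rewrite dot3Zr mulNr mulfK ?opprK //.
by rewrite gt_eqF // dot3_gt0.
Qed.

Lemma scalerN_inj x nu k l : x != 0 ->
  nu = - k *: x -> nu = - l *: x -> k = l.
Proof.
move=> x0 -> /eqP; rewrite -subr_eq0 -scalerBl scaler_eq0 (negbTE x0) orbF.
by rewrite opprK addrC subr_eq0 => /eqP.
Qed.

(** Dotting x Q_u + y Q_v with the frame (P, Q, N) loses nothing; the first two
components come out multiplied by a = |P| and b = |Q|. *)
Lemma pencil_eq0 (P Q N Lu Lv : 'rV[R]_3) (a b c cb sb s k l w t rho x y : R) :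
  a != 0 -> b != 0 -> frame P Q N \in unitmx ->
  dot3 P P = a ^+ 2 -> dot3 Q Q = b ^+ 2 ->
  dot3 P Q = 0 -> dot3 P N = 0 -> dot3 Q N = 0 ->
  dot3 Lu P = - a * (c * sb * w + s * k * a) ->
  dot3 Lu Q = b * (c * cb * w) -> dot3 Lu N = c * cb * k * a ->
  dot3 Lv Q = - b * (c * cb * - t + s * l * b) ->
  dot3 Lv P = a * (c * sb * - t) -> dot3 Lv N = c * sb * l * b ->
  x *: (- P - rho *: Lu) + y *: (- Q - rho *: Lv) = 0 <->
  [/\ x * (- a + rho * (c * sb * w + s * k * a)) + y * (rho * (c * sb * t)) = 0,
     x * - (rho * (c * cb * w)) + y * (- b + rho * (- (c * cb * t) + s * l * b)) = 0
   & x * - (rho * (c * cb * k * a)) + y * - (rho * (c * sb * l * b)) = 0].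
Proof.
move=> a0 b0 Fu PP QQ PQ PN QN LuP LuQ LuN LvQ LvP LvN.
have dotE z : dot3 (x *: (- P - rho *: Lu) + y *: (- Q - rho *: Lv)) z =
    x * (- dot3 P z - rho * dot3 Lu z) + y * (- dot3 Q z - rho * dot3 Lv z).
  by rewrite !(dot3Dl, dot3Zl, dot3Nl).
apply: (iff_trans (frame_separates _ Fu)).
rewrite !dotE PP QQ PQ (dot3C Q) PQ PN QN LuP LuQ LuN LvQ LvP LvN oppr0 !sub0r.
split=> -[e1 e2 e3]; split.
- by apply: (mulfI a0); rewrite mulr0 -e1; ring.
- by apply: (mulfI b0); rewrite mulr0 -e2; ring.
- by rewrite -e3; ring.
- by rewrite -[RHS](mulr0 a) -e1; ring.
- by rewrite -[RHS](mulr0 b) -e2; ring.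
- by rewrite -e3; ring.
Qed.

End VectorIdentities.

(** * Surfaces in curvature line coordinates *)

Section CurvatureLineCoordinates.
Context {R : realType} {U : set (R * R)} {phi N : R * R -> 'rV[R]_3}.
Hypotheses (Uo : open U) (phis : smooth2_on U phi).
Hypothesis phi_regular :
  forall p, U p -> row_free (col_mx (pdu phi p) (pdv phi p)).
Hypothesis hN : unit_normal U phi N.
Hypothesis hcurv : curvature_line_coordinates U phi N.
Hypothesis humb : forall q, U q -> ~ umbilic phi N q.

Let Ns : smooth2_on U N. Proof. by case: hN. Qed.
Let us : smooth2_on U (pdu phi). Proof. exact: smooth2_pdu. Qed.
Let vs : smooth2_on U (pdv phi). Proof. exact: smooth2_pdv. Qed.

Lemma tangent_free q (a b : R) : U q ->
  a *: pdu phi q + b *: pdv phi q = 0 -> a = 0 /\ b = 0.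
Proof.
move=> Uq E; have /eqP rk := phi_regular Uq.
have no_pencil : ~ (a != 0 \/ b != 0).
  move=> ab0; suff : (\rank (col_mx (pdu phi q) (pdv phi q)) < 2)%N by rewrite rk.
  by apply/rank_col_mx_lt2; exists a, b.
by split; apply/eqP/negPn/negP => ?; apply: no_pencil; [left|right].
Qed.

Lemma pdu_neq0 q : U q -> pdu phi q != 0.
Proof.
move=> Uq; apply/eqP => u0; have [|/eqP] := @tangent_free q 1 0 Uq.
  by rewrite u0 scaler0 scale0r addr0.
by rewrite oner_eq0.
Qed.

Lemma pdv_neq0 q : U q -> pdv phi q != 0.
Proof.
move=> Uq; apply/eqP => v0; have [|_ /eqP] := @tangent_free q 0 1 Uq.
  by rewrite v0 scaler0 scale0r addr0.
by rewrite oner_eq0.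
Qed.

Lemma dot3_pdu_normal q : U q -> dot3 (pdu phi q) (N q) = 0.
Proof. by move=> Uq; rewrite dot3C; have [_ /(_ _ Uq)[]] := hN. Qed.

Lemma dot3_pdv_normal q : U q -> dot3 (pdv phi q) (N q) = 0.
Proof. by move=> Uq; rewrite dot3C; have [_ /(_ _ Uq)[]] := hN. Qed.

(** Rodrigues' formulas.  If the two eigenvalues agreed, the shape operator would
be a multiple of the identity, and the point umbilic. *)
Lemma rodrigues q : U q -> exists k1 k2 : R,
  [/\ k1 != k2, pdu N q = - k1 *: pdu phi q & pdv N q = - k2 *: pdv phi q].
Proof.
move=> Uq; have [[k1 [_ Nu]] [k2 [_ Nv]]] := hcurv Uq.
rewrite !tangent_map_u in Nu; rewrite !tangent_map_v in Nv.
have {}Nu : pdu N q = - k1 *: pdu phi q by rewrite scaleNr -Nu opprK.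
have {}Nv : pdv N q = - k2 *: pdv phi q by rewrite scaleNr -Nv opprK.
exists k1, k2; split; [|exact: Nu|exact: Nv]; apply/eqP => k12; apply: (humb Uq).
suff curv_eq k : principal_curvature phi N q k -> k = k1.
  by move=> k l /curv_eq -> /curv_eq ->.
move=> [[w1 w2] [w0]]; rewrite /tangent_map /= Nu Nv -k12.
move=> /eigen_combination /(tangent_free Uq)[].
move=> /eqP; rewrite mulf_eq0 subr_eq0.
have [-> //|/= kk1 /eqP w10] := eqVneq k1 k.
move=> /eqP; rewrite mulf_eq0 subr_eq0 (negbTE kk1) /= => /eqP w20.
by move: w0; rewrite w10 w20 eqxx.
Qed.

(** Both <N_u, phi_v> and <N_v, phi_u> equal minus <N, phi_uv>. *)
Lemma fundF_eq0 q : U q -> dot3 (pdu phi q) (pdv phi q) = 0.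
Proof.
move=> Uq; have [k1 [k2 [k12 Nu Nv]]] := rodrigues Uq.
have NP x : U x -> dot3 (N x) (pdu phi x) = 0.
  by move=> Ux; rewrite dot3C dot3_pdu_normal.
have NQ x : U x -> dot3 (N x) (pdv phi x) = 0.
  by move=> Ux; rewrite dot3C dot3_pdv_normal.
have Eu := derive_dot3_const Uo Uq NQ (smooth2_is_derive_u Ns Uq)
             (smooth2_is_derive_u vs Uq).
have Ev := derive_dot3_const Uo Uq NP (smooth2_is_derive_v Ns Uq)
             (smooth2_is_derive_v us Uq).
rewrite (pdv_pdu Uo phis Uq) in Ev.
exact: orthogonal_of_symmetric k12 Nu Nv Eu Ev.
Qed.

Lemma pdu_normal q : U q -> pdu N q = - kappa1 phi N q *: pdu phi q.
Proof.
move=> Uq; have [k1 [_ [_ Nu _]]] := rodrigues Uq.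
have E := derive_dot3_const Uo Uq dot3_pdu_normal (smooth2_is_derive_u us Uq)
            (smooth2_is_derive_u Ns Uq).
apply: (etrans Nu); congr (- _ *: _); apply/esym.
exact: normal_curvature_eigenvalue (pdu_neq0 Uq) Nu E.
Qed.

Lemma pdv_normal q : U q -> pdv N q = - kappa2 phi N q *: pdv phi q.
Proof.
move=> Uq; have [_ [k2 [_ _ Nv]]] := rodrigues Uq.
have E := derive_dot3_const Uo Uq dot3_pdv_normal (smooth2_is_derive_v vs Uq)
            (smooth2_is_derive_v Ns Uq).
apply: (etrans Nv); congr (- _ *: _); apply/esym.
exact: normal_curvature_eigenvalue (pdv_neq0 Uq) Nv E.
Qed.

Lemma kappa_neq q : U q -> kappa1 phi N q != kappa2 phi N q.
Proof.
move=> Uq; have [k1 [k2 [k12 Nu Nv]]] := rodrigues Uq.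
rewrite -(scalerN_inj (pdu_neq0 Uq) Nu (pdu_normal Uq)).
by rewrite -(scalerN_inj (pdv_neq0 Uq) Nv (pdv_normal Uq)).
Qed.

Lemma gauss_curvature_kappa q : U q ->
  gauss_curvature phi N q = kappa1 phi N q * kappa2 phi N q.
Proof.
move=> Uq.
have -> : gauss_curvature phi N q = (funde phi N q * fundg phi N q - 0 ^+ 2) /
    (fundE phi q * fundG phi q - 0 ^+ 2).
  rewrite /gauss_curvature /fundF fundF_eq0 // /fundf.
  have -> := derive_dot3_const Uo Uq dot3_pdu_normal (smooth2_is_derive_v us Uq)
             (smooth2_is_derive_v Ns Uq).
  by rewrite pdv_normal // dot3Zr fundF_eq0 // mulr0 oppr0.
by rewrite expr0n /= !subr0 mulf_div.
Qed.

(** Since F = 0 identically, <phi_uu, phi_v> = - <phi_u, phi_uv> = - E_v / 2. *)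
Lemma pdu_pdu_dot_pdv q : U q ->
  dot3 (pdu (pdu phi) q) (pdv phi q) = - (pdv (fundE phi) q / 2).
Proof.
move=> Uq.
have -> := derive_dot3_const Uo Uq fundF_eq0 (smooth2_is_derive_u us Uq)
             (smooth2_is_derive_u vs Uq).
have Pd := smooth2_is_derive_v us Uq.
have [_] := is_derive_dot3 Pd Pd.
rewrite -/(fundE phi) -/(pdv (fundE phi) q) => ->.
by rewrite -(pdv_pdu Uo phis Uq) dot3C; field.
Qed.

Lemma pdv_pdv_dot_pdu q : U q ->
  dot3 (pdv (pdv phi) q) (pdu phi q) = - (pdu (fundG phi) q / 2).
Proof.
move=> Uq.
have F0 x : U x -> dot3 (pdv phi x) (pdu phi x) = 0.
  by move=> Ux; rewrite dot3C fundF_eq0.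
have -> := derive_dot3_const Uo Uq F0 (smooth2_is_derive_v vs Uq)
             (smooth2_is_derive_v us Uq).
have Qd := smooth2_is_derive_u vs Uq.
have [_] := is_derive_dot3 Qd Qd.
rewrite -/(fundG phi) -/(pdu (fundG phi) q) => ->.
by rewrite (pdv_pdu Uo phis Uq) dot3C; field.
Qed.

Lemma moving_frame_unit q : U q -> moving_frame phi N q \in unitmx.
Proof.
move=> Uq; have [_ /(_ _ Uq)[NN _ _]] := hN.
exact: orthogonal_frame_unit (pdu_neq0 Uq) (pdv_neq0 Uq) (fundF_eq0 Uq)
  (dot3_pdu_normal Uq) (dot3_pdv_normal Uq) NN.
Qed.

Lemma rank_envelopeJ alpha beta rho X q : U q ->
  \rank (envelopeJ phi N alpha beta rho X q) =
  \rank (col_mx (pdu (lineQ phi N alpha beta rho X) q)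
                (pdv (lineQ phi N alpha beta rho X) q)).
Proof.
move=> Uq; apply: mxrankMfree; rewrite row_free_unit unitmx_inv.
exact: moving_frame_unit.
Qed.

Lemma derive_lineQ alpha beta rho X q v dphi dL :
  is_derive q v phi dphi ->
  is_derive q v (line_direction phi N alpha beta) dL ->
  'D_v (lineQ phi N alpha beta rho X) q = - dphi - rho *: dL.
Proof.
move=> dp dl.
have [_ E] := is_deriveB (is_deriveB (is_derive_cst X q v) dp) (is_deriveZ rho dl).
by apply: (etrans E); rewrite sub0r.
Qed.

Lemma envelope_pencil alpha beta (r : R * R -> R) q : U q ->
  let a := enorm (pdu phi q) in let b := enorm (pdv phi q) in
  let c := cos alpha in let s := sin alpha in
  let w := - (pdv (fundE phi) q / (2 * b * a)) in
  let t := pdu (fundG phi) q / (2 * a * b) in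
  envelope_has_solution phi N alpha beta r q <->
  exists x y : R, [/\ x != 0 \/ y != 0,
     x * (- a + r q * (c * sin beta * w + s * kappa1 phi N q * a)) +
       y * (r q * (c * sin beta * t)) = 0,
     x * - (r q * (c * cos beta * w)) +
       y * (- b + r q * (- (c * cos beta * t) + s * kappa2 phi N q * b)) = 0
   & x * - (r q * (c * cos beta * kappa1 phi N q * a)) +
       y * - (r q * (c * sin beta * kappa2 phi N q * b)) = 0].
Proof.
move=> Uq a b c s w t.
have QP x : U x -> dot3 (pdv phi x) (pdu phi x) = 0.
  by move=> Ux; rewrite dot3C fundF_eq0.
have a0 : a != 0 by exact: enorm_neq0 (pdu_neq0 Uq).
have b0 : b != 0 by exact: enorm_neq0 (pdv_neq0 Uq).
have wE : dot3 (pdu (pdu phi) q) (pdv phi q) / (a * b) = w.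
  by rewrite (pdu_pdu_dot_pdv Uq); exact: half_quotient.
have tE : dot3 (pdv (pdv phi) q) (pdu phi q) / (b * a) = - t.
  by rewrite (pdv_pdv_dot_pdu Uq); exact: half_quotient.
have [Lu [Lud LuP LuQ LuN]] := derive_frame_combination (c * cos beta)
  (c * sin beta) s Uo Uq pdu_neq0 pdv_neq0 fundF_eq0 dot3_pdu_normal
  dot3_pdv_normal (smooth2_is_derive_u us Uq) (smooth2_is_derive_u vs Uq)
  (smooth2_is_derive_u Ns Uq) (pdu_normal Uq) wE.
have [Lv [Lvd LvQ LvP LvN]] := derive_frame_combination (c * sin beta)
  (c * cos beta) s Uo Uq pdv_neq0 pdu_neq0 QP dot3_pdv_normal
  dot3_pdu_normal (smooth2_is_derive_v vs Uq) (smooth2_is_derive_v us Uq)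
  (smooth2_is_derive_v Ns Uq) (pdv_normal Uq) tE.
have LE : (fun x => (c * sin beta / enorm (pdv phi x)) *: pdv phi x +
    (c * cos beta / enorm (pdu phi x)) *: pdu phi x + s *: N x) =
    line_direction phi N alpha beta.
  by apply/funext => x; exact: addr_swap.
rewrite LE in Lvd.
have pencil rho x y := pencil_eq0 rho x y a0 b0 (moving_frame_unit Uq) (enorm_sqr _)
  (enorm_sqr _)
  (fundF_eq0 Uq) (dot3_pdu_normal Uq) (dot3_pdv_normal Uq)
  LuP LuQ LuN LvQ LvP LvN.
have Qu X : pdu (lineQ phi N alpha beta (r q) X) q = - pdu phi q - r q *: Lu.
  exact: derive_lineQ (smooth2_is_derive_u phis Uq) Lud.
have Qv X : pdv (lineQ phi N alpha beta (r q) X) q = - pdv phi q - r q *: Lv.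
  exact: derive_lineQ (smooth2_is_derive_v phis Uq) Lvd.
split.
  move=> [X [_]]; rewrite (rank_envelopeJ _ _ _ _ Uq) Qu Qv.
  move=> /rank_col_mx_lt2[x [y [xy0 /pencil[e1 e2 e3]]]].
  by exists x, y; split.
move=> [x [y [xy0 e1 e2 e3]]].
exists (phi q + r q *: line_direction phi N alpha beta q); split.
  by rewrite /lineQ -addrA -opprD subrr.
rewrite (rank_envelopeJ _ _ _ _ Uq) Qu Qv; apply/rank_col_mx_lt2; exists x, y.
split; [exact: xy0|apply: (pencil _ x y).2].
by split; [exact: e1|exact: e2|exact: e3].
Qed.

End CurvatureLineCoordinates.

(** * Solving for the angle and the radius *)

Lemma radius_formula (R : realFieldType) (a b c s k m rho : R) :
  a != 0 -> b != 0 -> c * m - 2 * s * a * b ^+ 2 * k != 0 ->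
  b = rho * (- (c * (m / (2 * a * b))) + s * k * b) <->
  rho = - (2 * a * b ^+ 2 / (c * m - 2 * s * a * b ^+ 2 * k)).
Proof.
move=> a0 b0 D0; split=> [bE|->]; last by field; rewrite D0 a0 b0.
apply: (mulIf D0); rewrite mulNr divfK //.
(* replacing one factor b only makes the equation linear in rho *)
rewrite expr2 [X in - (_ * _ * (X * _))]bE; field.
by rewrite a0 b0.
Qed.

(** sin(beta) = 0 makes beta an even multiple of pi/2, and among the allowed
indices 0 and 1 only 0 is even; similarly for cosine and odd multiples. *)
Lemma sin_eq0_restricted (R : realType) (beta : R) :
  (forall k : int, beta = k%:~R * (pi / 2) -> k = 0 \/ k = 1) ->
  sin beta = 0 <-> beta = 0.
Proof.
move=> hbeta; split=> [/sin_eq0[n nE]|->]; last exact: sin0.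
have [|n0|n1] := hbeta (n * 2); last by lia.
  by rewrite nE intrM; field.
have {}n0 : n = 0 by lia.
by rewrite nE n0 mul0r.
Qed.

Lemma cos_eq0_restricted (R : realType) (beta : R) :
  (forall k : int, beta = k%:~R * (pi / 2) -> k = 0 \/ k = 1) ->
  cos beta = 0 <-> beta = pi / 2.
Proof.
move=> hbeta; split=> [/cos_eq0[n nE]|->]; last exact: cos_pihalf.
have [|n0|n1] := hbeta (n * 2 - 1).
- by rewrite nE intrB intrM; field.
- by lia.
have {}n1 : n = 1 by lia.
by rewrite nE n1; field.
Qed.

Lemma focal_cases (R : realType) (beta a b c s k l m n E G rho : R) :
  (forall i : int, beta = i%:~R * (pi / 2) -> i = 0 \/ i = 1) ->
  a != 0 -> b != 0 -> E = a ^+ 2 -> G = b ^+ 2 ->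
  c * m - 2 * s * a * G * l != 0 -> c * n - 2 * s * b * E * k != 0 ->
  (sin beta = 0 /\
     b = rho * (- (c * cos beta * (m / (2 * a * b))) + s * l * b)) \/
  (cos beta = 0 /\
     a = rho * (c * sin beta * - (n / (2 * b * a)) + s * k * a)) <->
  (beta = 0 /\ rho = - (2 * a * G / (c * m - 2 * s * a * G * l))) \/
  (beta = pi / 2 /\ rho = - (2 * b * E / (c * n - 2 * s * b * E * k))).
Proof.
move=> hbeta a0 b0 -> -> D1 D2.
have sinE := sin_eq0_restricted hbeta; have cosE := cos_eq0_restricted hbeta.
split=> -[[B bE]|[B bE]].
- move/sinE: B bE => ->; rewrite cos0 mulr1 => bE.
  by left; split=> //; apply/radius_formula.
- move/cosE: B bE => ->; rewrite sin_pihalf mulr1 mulrN => bE.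
  by right; split=> //; apply/radius_formula.
- left; rewrite B sin0 cos0 mulr1; split=> //.
  by apply/radius_formula.
- right; rewrite B cos_pihalf sin_pihalf mulr1 mulrN; split=> //.
  by apply/radius_formula.
Qed.

Theorem proposition2p2 (R : realType) (S : set 'rV[R]_3) (U : set (R * R))
    (phi N : R * R -> 'rV[R]_3) (r : R * R -> R) (alpha beta : R) (p : R * R)
    (hS : regular_surface S)
    (hphi : local_parametrization S U phi)
    (hN : unit_normal U phi N)
    (hcurv : curvature_line_coordinates U phi N)
    (hpar : forall q, U q -> ~ parabolic phi N q)
    (humb : forall q, U q -> ~ umbilic phi N q)
    (halpha : 0 < alpha < pi / 2)
    (hbeta : forall k : int, beta = k%:~R * (pi / 2) -> k = 0 \/ k = 1)
    (hp : U p)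
    (hden1 : cos alpha * pdu (fundG phi) p
      - 2 * sin alpha * Num.sqrt (fundE phi p) * fundG phi p * kappa2 phi N p
      != 0)
    (hden2 : cos alpha * pdv (fundE phi) p
      - 2 * sin alpha * Num.sqrt (fundG phi p) * fundE phi p * kappa1 phi N p
      != 0) :
  envelope_has_solution phi N alpha beta r p <->
  (beta = 0 /\
   r p = - (2 * Num.sqrt (fundE phi p) * fundG phi p /
     (cos alpha * pdu (fundG phi) p
      - 2 * sin alpha * Num.sqrt (fundE phi p) * fundG phi p * kappa2 phi N p)))
  \/
  (beta = pi / 2 /\
   r p = - (2 * Num.sqrt (fundG phi p) * fundE phi p /
     (cos alpha * pdv (fundE phi) p
      - 2 * sin alpha * Num.sqrt (fundG phi p) * fundE phi p * kappa1 phi N p))).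
Proof.
have [Uo phis _ _ reg] := hphi.
apply: (iff_trans (envelope_pencil Uo phis reg hN hcurv humb alpha beta r hp)).
have P0 := pdu_neq0 reg hp; have Q0 := pdv_neq0 reg hp.
have /eqP := hpar _ hp.
rewrite (gauss_curvature_kappa Uo phis reg hN hcurv humb hp) mulf_eq0 negb_or.
move=> /andP[k10 k20].
have c0 : cos alpha != 0.
  case/andP: halpha => al0 al1; rewrite gt_eqF // cos_gt0_pihalf // al1 andbT.
  by rewrite (lt_trans _ al0) // oppr_lt0 divr_gt0 // pi_gt0.
have k12 := kappa_neq Uo phis reg hN hcurv humb hp.
apply: (iff_trans (degenerate_pencil _ _ _ _ (enorm_neq0 P0) (enorm_neq0 Q0)
  c0 k10 k20 k12 (cos2Dsin2 beta))).
exact: focal_cases hbeta (enorm_neq0 P0) (enorm_neq0 Q0) (enorm_sqr _)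
  (enorm_sqr _) hden1 hden2.
Qed.
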